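(* Let $\mathbb{F}$ be a finite field and let $C\subseteq\mathbb{F}^n$ be a linear code. If $C$ is a metacyclic group code, then $C$ is an abelian group code.
   Context: A linear code of length $n$ over $\mathbb{F}$ is a linear subspace of $\mathbb{F}^n$; $E=\{e_1,\dots,e_n\}$ is the standard basis of $\mathbb{F}^n$. For a group $G$ of order $n$, a linear code $C\subseteq\mathbb{F}^n$ is a $G$-code if there is a bijection $\phi:E\to G$ whose linear extension $\phi:\mathbb{F}^n\to\mathbb{F}G$ to the group algebra maps $C$ onto a two-sided ideal of $\mathbb{F}G$. A group $G$ is metacyclic if it has a cyclic normal subgroup $N$ such that $G/N$ is cyclic. A metacyclic (respectively, abelian) group code is a linear code which is a $G$-code for some metacyclic (respectively, abelian) group $G$. *)

(* Defs.v *)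
From HB Require Import structures.
From mathcomp Require Import all_boot all_order all_fingroup all_algebra.
From mathcomp Require Import all_solvable all_field all_character.

Set Implicit Arguments.
Unset Strict Implicit.
Unset Printing Implicit Defensive.

Import GRing.Theory.
Local Open Scope ring_scope.

(* The group algebra of G over F is the library's [group_ring F G], in which
   x \in G is represented by the matrix [regular_repr F G x]; these matrices
   are linearly independent (group_ring_free) and multiply as in G. *)

(* A bijection from the standard basis to G is given by phi : 'I_n -> gT, the
   basis vector e_i = delta_mx 0 i being sent to phi i. *)
Definition linear_ext (F : fieldType) (gT : finGroupType) (G : {group gT})
    (n : nat) (phi : 'I_n -> gT) (c : 'rV[F]_n) : 'M[F]_#|G| :=
  \sum_(i < n) c 0 i *: regular_repr F G (phi i).

Lemma linear_ext_delta (F : fieldType) (gT : finGroupType) (G : {group gT})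
    (n : nat) (phi : 'I_n -> gT) (i : 'I_n) :
  linear_ext G phi (delta_mx 0 i) = regular_repr F G (phi i).
Proof.
rewrite /linear_ext (bigD1 i) //= mxE !eqxx scale1r big1 ?addr0 // => j ne_ji.
by rewrite mxE (negPf ne_ji) andbF scale0r.
Qed.

(* [mx_ideal] only states closure under multiplication by [group_ring F G] on
   both sides, so the inclusion is a separate conjunct. *)
Definition two_sided_ideal (F : fieldType) (gT : finGroupType)
    (G : {group gT}) (I : 'A[F]_#|G|) : bool :=
  (I <= group_ring F G)%MS && mx_ideal (group_ring F G) I.

(* The two conditions on phi force #|G| = n. *)
Definition group_code (F : fieldType) (gT : finGroupType) (G : {group gT})
    (n : nat) (C : {vspace 'rV[F]_n}) : Prop :=
  exists phi : 'I_n -> gT,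
    [/\ injective phi,
        [set phi i | i : 'I_n] = G
      & exists2 I : 'A[F]_#|G|, two_sided_ideal I
          & forall x : 'M[F]_#|G|,
              (x \in I)%MS <-> exists2 c, c \in C & x = linear_ext G phi c].

Definition metacyclic_group_code (F : fieldType) (n : nat)
    (C : {vspace 'rV[F]_n}) : Prop :=
  exists (gT : finGroupType) (G : {group gT}), metacyclic G /\ group_code G C.

Definition abelian_group_code (F : fieldType) (n : nat)
    (C : {vspace 'rV[F]_n}) : Prop :=
  exists (gT : finGroupType) (G : {group gT}), abelian G /\ group_code G C.

(* Main.v *)
(** Let [A] and [B] be abelian subgroups with [G = A B].  The left translations
    of [G] by [A] and the right translations by [B] commute, so together they
    generate an abelian group [K] of permutations of [G], transitive because
    [G = A B].  An abelian transitive group is regular, so [K] can replace [G]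
    as index set; a two-sided ideal of the group algebra of [G] is stable under
    all translations, hence becomes an ideal of the group algebra of [K].
    A metacyclic group is such a product, [B] being generated by a lift of a
    generator of the cyclic quotient. *)

From HB Require Import structures.
Require Import Defs.
From mathcomp Require Import all_boot all_order all_fingroup all_algebra.
From mathcomp Require Import all_solvable all_character.

Set Implicit Arguments.
Unset Strict Implicit.
Unset Printing Implicit Defensive.

Import GRing.Theory GroupScope.
Local Open Scope ring_scope.

Section LinearExt.

Variables (F : fieldType) (gT : finGroupType) (G : {group gT}) (n : nat).
Variable phi : 'I_n -> gT.
Hypothesis phiG : forall i, phi i \in G.

Lemma linear_ext_is_linear : linear (linear_ext (F := F) G phi).
Proof.
move=> a c d; rewrite /linear_ext scaler_sumr -big_split /=.
by apply: eq_bigr => i _; rewrite !mxE scalerDl scalerA.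
Qed.

Lemma linear_ext_sum (I : finType) (u : I -> F) (c : I -> 'rV[F]_n) :
  linear_ext G phi (\sum_i u i *: c i) = \sum_i u i *: linear_ext G phi (c i).
Proof.
pose f : {linear 'rV[F]_n -> 'M[F]_#|G|} :=
  HB.pack (linear_ext (F := F) G phi)
    (GRing.isLinear.Build _ _ _ _ _ linear_ext_is_linear).
rewrite -[linear_ext G phi]/(f : _ -> _) linear_sum.
by apply: eq_bigr => i _; rewrite linearZ.
Qed.

Lemma linear_ext_inj : injective phi -> injective (linear_ext (F := F) G phi).
Proof.
move=> phi_inj c d eq_cd; apply/rowP => k.
(* [gring_proj (phi k)] reads off the coefficient of [phi k] in the group algebra; injectivity of
   [phi] leaves only the term [i = k]. *)
have coef (e : 'rV[F]_n) :
    gring_proj (phi k) (linear_ext G phi e) = (e 0 k)%:M.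
  rewrite /linear_ext linear_sum (bigD1 k) //= linearZ /= gring_projE // eqxx.
  rewrite scalemx1 big1 ?addr0 // => i ne_ik; rewrite linearZ /= gring_projE //.
  by rewrite (inj_eq phi_inj) eq_sym (negPf ne_ik) scaler0.
by have := coef c; rewrite eq_cd coef => /rowP/(_ 0); rewrite !mxE !mulr1n.
Qed.

(** Reindexing the sum by [s] suffices, as [col_perm s c] has entry [c 0 (s i)] at [i]. Thus
    [col_perm s] acts on codewords as translation by the inverses of [a] and [b]. *)
Lemma linear_ext_translate (s : 'S_n) (a b : gT) (c : 'rV[F]_n) :
    a \in G -> b \in G -> (forall i, phi (s i) = a * phi i * b)%g ->
  linear_ext G phi c =
    regular_repr F G a *m linear_ext G phi (col_perm s c) *m regular_repr F G b.
Proof.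
move=> Ga Gb phi_s; rewrite /linear_ext (reindex_perm s) /=.
rewrite mulmx_sumr mulmx_suml; apply: eq_bigr => i _.
by rewrite phi_s !repr_mxM ?groupM // -scalemxAr -scalemxAl mxE.
Qed.

Lemma linear_ext_group_ring (c : 'rV[F]_n) :
  (linear_ext G phi c \in group_ring F G)%MS.
Proof.
rewrite /linear_ext linear_sum summx_sub // => i _.
by rewrite linearZ scalemx_sub // envelop_mx_id.
Qed.

End LinearExt.

Section Paut.

Variables (F : fieldType) (n : nat) (C : {vspace 'rV[F]_n}).

(** The permutation automorphism group of the code; the inclusion is an equality, since permuting
    coordinates preserves dimension. *)
Definition paut : {set 'S_n} :=
  [set s | (linfun (col_perm s) @: C <= C)%VS].

Lemma pautP (s : 'S_n) :
  reflect (forall c, c \in C -> col_perm s c \in C) (s \in paut).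
Proof.
rewrite inE; apply: (iffP subvP) => sC c.
  by move=> Cc; rewrite -[col_perm s c](lfunE (col_perm s)) sC ?memv_img.
by case/memv_imgP=> d Cd ->; rewrite lfunE; apply: sC.
Qed.

Lemma paut_group_set : group_set paut.
Proof.
apply/group_setP; split=> [|s t /pautP sC /pautP tC].
  by apply/pautP=> c; rewrite col_perm1.
by apply/pautP=> c Cc; rewrite col_permM; auto.
Qed.

Canonical paut_group := group paut_group_set.

End Paut.

(** Multiplying by group elements on either side preserves a two-sided ideal. This turns the ideal
    property into a statement about coordinate permutations alone. *)
Lemma group_code_paut (F : fieldType) (gT : finGroupType) (G : {group gT})
    (n : nat) (C : {vspace 'rV[F]_n}) : group_code G C ->
  exists phi : 'I_n -> gT,
    [/\ injective phi, [set phi i | i : 'I_n] = G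
      & forall (s : 'S_n) a b, a \in G -> b \in G ->
          (forall i, phi (s i) = a * phi i * b)%g -> s \in paut C].
Proof.
case=> phi [phi_inj imphi [I /andP[_ /andP[idl idr]] CI]].
have phiG i : phi i \in G by rewrite -[G : {set _}]imphi imset_f.
exists phi; split=> // s a b Ga Gb phi_s; apply/pautP=> c Cc.
have eq_c := linear_ext_translate phiG c Ga Gb phi_s.
(* An element of [I] is the image of a codeword [d], and injectivity of the extension identifies [d]
   with [col_perm s c]. *)
suff /CI[d Cd /(linear_ext_inj phiG phi_inj)->//] :
  (linear_ext G phi (col_perm s c) \in I)%MS.
have Ic : (linear_ext G phi c \in I)%MS by apply/CI; exists c.
have -> : linear_ext G phi (col_perm s c) =
    regular_repr F G a^-1%g *m linear_ext G phi c *m regular_repr F G b^-1%g.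
  by rewrite eq_c !mulmxA -repr_mxM ?groupV // mulVg repr_mx1 mul1mx
    -mulmxA -repr_mxM ?groupV // mulgV repr_mx1 mulmx1.
move/mulsmx_subP: idr; apply; last by rewrite envelop_mx_id ?groupV.
by move/mulsmx_subP: idl; apply; rewrite ?envelop_mx_id ?groupV.
Qed.

(** Converse transfer: right translations coming from automorphisms of [C] make its image a right
    ideal, and commutativity of [K] makes it two-sided. *)
Lemma abelian_paut_group_code (F : fieldType) (n : nat)
    (C : {vspace 'rV[F]_n}) (gT : finGroupType) (K : {group gT})
    (psi : 'I_n -> gT) :
    abelian K -> injective psi -> [set psi i | i : 'I_n] = K ->
    (forall k, k \in K ->
       exists2 s, s \in paut C & forall i, psi (s i) = psi i * k)%g ->
  group_code K C.
Proof.
move=> abK psi_inj impsi translK; exists psi; split=> //.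
have psiK i : psi i \in K by rewrite -[K : {set _}]impsi imset_f.
(* The image of [C], spanned by the flattened images of a basis. *)
pose I : 'A[F]_#|K| :=
  (\sum_(i < \dim C) <<mxvec (linear_ext K psi (vbasis C)`_i)>>)%MS.
have memI (x : 'M_#|K|) :
    (x \in I)%MS <-> exists2 c, c \in C & x = linear_ext K psi c.
  split=> [/sub_sums_genmxP[u def_x] | [c Cc ->]].
    exists (\sum_(i < \dim C) u i 0 0 *: (vbasis C)`_i).
      by rewrite memv_suml // => i _; rewrite memvZ ?vbasis_mem ?memt_nth.
    apply: (can_inj mxvecK); rewrite def_x linear_ext_sum linear_sum /=.
    by apply: eq_bigr => i _; rewrite [u i]mx11_scalar mul_scalar_mx !mxE
      linearZ.
  rewrite [c in linear_ext _ _ c](coord_vbasis Cc) linear_ext_sum linear_sum.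
  apply: summx_sub => i _; rewrite linearZ scalemx_sub //.
  by rewrite (sumsmx_sup i) // genmxE.
have IR x k : (x \in I)%MS -> k \in K ->
    (x *m regular_repr F K k \in I)%MS.
  move=> /memI[c Cc ->] Kk; have [s sC psi_s] := translK k Kk.
  (* The inverse appears because [linear_ext_translate] undoes [col_perm s]; it stays in [paut C],
     which is a group. *)
  apply/memI; exists (col_perm s^-1%g c).
    by apply/pautP => //; rewrite groupV.
  have := linear_ext_translate (s := s) (a := 1%g) (b := k)
    psiK (col_perm s^-1%g c) (group1 K) Kk.
  rewrite -col_permM mulgV col_perm1 repr_mx1 mul1mx => -> // i.
  by rewrite mul1g.
have IL x k : (x \in I)%MS -> k \in K ->
    (regular_repr F K k *m x \in I)%MS.
  move=> Ix Kk; have:= IR x k Ix Kk; case/memI: Ix => c _ ->.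
  suff -> : regular_repr F K k *m linear_ext K psi c =
    linear_ext K psi c *m regular_repr F K k by [].
  rewrite mulmx_sumr mulmx_suml; apply: eq_bigr => i _.
  by rewrite -scalemxAr -scalemxAl -!repr_mxM // (centsP abK).
exists I => //; apply/and3P; split.
- apply/memmx_subP => x /memI[c _ ->]; exact: linear_ext_group_ring.
- apply/mulsmx_subP => x y /envelop_mxP[u ->] Iy.
  rewrite mulmx_suml linear_sum summx_sub // => k Kk.
  by rewrite -scalemxAl linearZ scalemx_sub ?IL.
apply/mulsmx_subP => x y Ix /envelop_mxP[u ->].
rewrite mulmx_sumr linear_sum summx_sub // => k Kk.
by rewrite -scalemxAr linearZ scalemx_sub ?IR.
Qed.

Lemma regular_abelian_group_code (F : fieldType) (n : nat)
    (C : {vspace 'rV[F]_n}) (K : {group 'S_n}) (i0 : 'I_n) :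
    abelian K -> K \subset paut C ->
    (forall i, exists2 k : 'S_n, k \in K & k i0 = i) ->
  group_code K C.
Proof.
move=> abK sKC transK.
(* Transitivity made into a choice function: [psi i] moves the base point [i0] to [i]. *)
have psiP i : {k : 'S_n | k \in K & k i0 = i}.
  have [k /andP[Kk /eqP]] : {k : 'S_n | (k \in K) && (k i0 == i)}.
    by apply/sigW; have [k Kk <-] := transK i; exists k; rewrite Kk /=.
  by exists k.
pose psi i := s2val (psiP i).
have psiK i : psi i \in K := s2valP (psiP i).
have psi_i0 i : psi i i0 = i := s2valP' (psiP i).
(* Regularity: every point is [psi i i0], and [psi i] commutes with [k] and [l], so agreement at
   [i0] spreads everywhere. *)
have regK k l : k \in K -> l \in K -> k i0 = l i0 -> k = l.
  move=> Kk Kl eq_kl; apply/permP => i; rewrite -[i]psi_i0 -!permM.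
  by rewrite !(centsP abK _ (psiK i)) // !permM eq_kl.
have psi_translate k i : k \in K -> psi (k i) = (psi i * k)%g.
  by move=> Kk; apply: regK; rewrite ?groupM // psi_i0 permM psi_i0.
apply: (abelian_paut_group_code (psi := psi)) => //.
- by apply: (can_inj (g := fun k : 'S_n => k i0)).
- apply/setP => k; apply/imsetP/idP => [[i _ ->] // | Kk].
  by exists (k i0); rewrite // (regK k (psi (k i0))) ?psi_i0.
by move=> k Kk; exists k => [|i]; [apply: (subsetP sKC) | apply: psi_translate].
Qed.

Lemma group_code_abelian_factors (F : fieldType) (gT : finGroupType)
    (G A B : {group gT}) (n : nat) (C : {vspace 'rV[F]_n}) :
    abelian A -> abelian B -> (A * B)%g = G ->
  group_code G C -> abelian_group_code C.
Proof.
move=> abA abB defG /group_code_paut[phi [phi_inj imphi phi_paut]].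
have [sAG sBG] : A \subset G /\ B \subset G.
  by rewrite -defG mulG_subl mulG_subr.
have phiG i : phi i \in G by rewrite -[G : {set _}]imphi imset_f.
pose L := [set s : 'S_n |
  [exists a in A, [forall i, phi (s i) == a * phi i]]]%g.
pose R := [set s : 'S_n |
  [exists b in B, [forall i, phi (s i) == phi i * b]]]%g.
have LP s : s \in L -> exists2 a, a \in A & forall i, phi (s i) = (a * phi i)%g.
  by rewrite inE => /exists_inP[a Aa /forallP s_a]; exists a => // i; apply/eqP.
have RP s : s \in R -> exists2 b, b \in B & forall i, phi (s i) = (phi i * b)%g.
  by rewrite inE => /exists_inP[b Bb /forallP s_b]; exists b => // i; apply/eqP.
have abLR : abelian <<L :|: R>>.
  have sym_comm (s t : 'S_n) :
      (forall i, phi (s (t i)) = phi (t (s i))) -> commute s t.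
    by move=> st; apply/permP => i; rewrite !permM; apply: phi_inj.
  rewrite abelian_gen; apply/centsP => s + t.
  (* The mixed cases are associativity; two left translations use [abA], two right ones [abB]. *)
  case/setUP=> [/LP | /RP] [a Aa s_a] /setUP[/LP | /RP] [b Bb t_b];
    apply: sym_comm => i; rewrite !(s_a, t_b) ?mulgA //.
    by rewrite (centsP abA _ Aa).
  by rewrite -!mulgA (centsP abB _ Aa).
have sKC : <<L :|: R>> \subset paut C.
  rewrite gen_subG; apply/subsetP => s /setUP[/LP | /RP] [a Aa s_a].
    apply: (phi_paut s a 1%g) => [||i]; rewrite ?(subsetP sAG) //.
    by rewrite s_a mulg1.
  apply: (phi_paut s 1%g a) => [||i]; rewrite ?(subsetP sBG) //.
  by rewrite s_a mul1g.
have phi_onto g : g \in G -> exists i, phi i = g.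
  by rewrite -[G : {set _}]imphi => /imsetP[i _ ->]; exists i.
(* Transports an injection of [G] into itself to a permutation of the indices. *)
have lift_perm (h : gT -> gT) :
      injective h -> (forall g, g \in G -> h g \in G) ->
    exists s : 'S_n, forall i, phi (s i) = h (phi i).
  move=> h_inj hG; have onto i : exists j, phi j == h (phi i).
    by have [j <-] := phi_onto _ (hG _ (phiG i)); exists j.
  have fE i : phi (xchoose (onto i)) = h (phi i).
    exact/eqP/(xchooseP (onto i)).
  have f_inj : injective (fun i => xchoose (onto i)).
    by move=> i j /(congr1 phi); rewrite !fE => /h_inj/phi_inj.
  by exists (perm f_inj) => i; rewrite permE.
(* The base point is the index of the identity, so writing [phi i] as [a * 1 * b] yields the
   permutation taking [i0] to [i]. *)
have [i0 phi_i0] := phi_onto _ (group1 G).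
exists _, <<L :|: R>>%G; split=> //.
apply: (@regular_abelian_group_code _ _ _ _ i0) => // i.
have /mulsgP[a b Aa Bb phi_i] : phi i \in (A * B)%g by rewrite defG.
have [Ga Gb] : a \in G /\ b \in G by rewrite (subsetP sAG) ?(subsetP sBG).
have [s s_a] : exists s : 'S_n, forall j, phi (s j) = (a * phi j)%g.
  by apply: (lift_perm (mulg a)) => [|g Gg]; [apply: mulgI | apply: groupM].
have [t t_b] : exists t : 'S_n, forall j, phi (t j) = (phi j * b)%g.
  by apply: (lift_perm (mulg^~ b)) => [|g Gg]; [apply: mulIg | apply: groupM].
exists (s * t)%g.
  rewrite groupM // mem_gen // !inE; apply/orP; [left | right].
    by apply/exists_inP; exists a => //; apply/forallP => j; rewrite s_a.
  by apply/exists_inP; exists b => //; apply/forallP => j; rewrite t_b.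
by apply: phi_inj; rewrite permM t_b s_a phi_i0 mulg1 phi_i.
Qed.

Lemma metacyclic_factors (gT : finGroupType) (G : {group gT}) :
  metacyclic G ->
  exists A B : {group gT}, [/\ abelian A, abelian B & (A * B)%g = G].
Proof.
case/metacyclicP=> H [cycH nHG /cyclicP[Hx]].
have [x Nx ->] := cosetP Hx => defGH.
exists H, <[x]>%G; split; rewrite ?cyclic_abelian ?cycle_cyclic //.
(* [H <[x]>] is the full preimage of [<[x]> / H], which is [G / H]; hence it is [G]. *)
by rewrite -quotientK ?cycle_subG // quotient_cycle // -defGH quotientGK.
Qed.

Theorem corollary3p2 (F : finFieldType) (n : nat) (C : {vspace 'rV[F]_n}) :
  metacyclic_group_code C -> abelian_group_code C.
Proof.
move=> [gT [G [/metacyclic_factors[A [B [abA abB defG]]]]]].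
exact: group_code_abelian_factors defG.
Qed.
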